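(* Let $n$ be a positive integer. Then, in $\mathbb{N}[x,y]$, $$\sum_{\sigma\in S_n^B}x^{\ell_B(\sigma)}y^{\mathrm{fmaj}(\sigma)}=\sum_{\sigma\in S_n^B}x^{\mathrm{nmaj}^*(\sigma)}y^{\mathrm{fmaj}(\sigma)}.$$
   Context: $S_n^B$ is the group of bijections $w$ of $[\pm n]=\{-n,\dots,-1,1,\dots,n\}$ with $w(-a)=-w(a)$, written as sequences $(w(1),\dots,w(n))$; it is a Coxeter group with generators $s_0=(-1,2,\dots,n)$ and $s_i=(1,\dots,i-1,i+1,i,i+2,\dots,n)$ for $1\le i\le n-1$, with length $\ell_B$. For $\sigma\in S_n^B$, $\mathrm{maj}(\sigma)=\sum_{i\in[n-1],\,\sigma(i)>\sigma(i+1)}i$ and $\mathrm{Neg}(\sigma)=\{i\in[n]:\sigma(i)<0\}$. The negative major index is $\mathrm{nmaj}(\sigma)=\mathrm{maj}(\sigma)-\sum_{i\in\mathrm{Neg}(\sigma)}\sigma(i)$, its inverse version is $\mathrm{nmaj}^*(\sigma):=\mathrm{nmaj}(\sigma^{-1})$, and the flag major index is $\mathrm{fmaj}(\sigma)=2\,\mathrm{maj}(\sigma)+|\mathrm{Neg}(\sigma)|$. *)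

(* Defs.v *)
From HB Require Import structures.
From mathcomp Require Import all_boot all_order all_algebra all_fingroup.
From mathcomp Require Import zify.

Set Implicit Arguments.
Unset Strict Implicit.
Unset Printing Implicit Defensive.

Import Order.TTheory GRing.Theory Num.Theory.

(* The set [±n] = {-n, ..., -1, 1, ..., n}: the pair (b, i) stands for the     *)
(* integer i+1 if b = false and -(i+1) if b = true (ordinals start at 0).      *)
Definition pmset (n : nat) : finType := (bool * 'I_n)%type.

Definition pmval (n : nat) (a : pmset n) : int :=
  ((-1) ^+ a.1 * a.2.+1%:Z)%R.

Definition pmopp (n : nat) (a : pmset n) : pmset n := (~~ a.1, a.2).

Lemma pmval_inj (n : nat) : injective (@pmval n).
Proof.
move=> [[] i] [[] j] //=; rewrite /pmval /= ?expr1 ?expr0 ?mulN1r ?mul1r.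
- by move=> /oppr_inj [] /val_inj ->.
- by move=> [] /val_inj ->.
Qed.

Lemma pmvalN (n : nat) (a : pmset n) : pmval (pmopp a) = (- pmval a)%R.
Proof. by case: a => [[] i]; rewrite /pmval /= ?mulN1r ?mul1r ?opprK. Qed.

Lemma pmval_range (n : nat) (z : int) :
  (exists a : pmset n, pmval a = z) <-> (0 < `|z| <= n)%N.
Proof.
split=> [[[b i] <-]|]; first by rewrite /pmval abszMsign /= ltn_ord.
case: z => [[|k]|k] //= hk; first by exists (false, Ordinal hk); rewrite /pmval /= mul1r.
by exists (true, Ordinal hk); rewrite /pmval /= mulN1r NegzE.
Qed.

Section SignedPermutations.
Variable n : nat.

Definition SB : {set {perm pmset n}} :=
  [set w : {perm pmset n} | [forall a, w (pmopp a) == pmopp (w a)]].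

Lemma SB_group_set : group_set SB.
Proof.
apply/group_setP; split; first by rewrite inE; apply/forallP => a; rewrite !perm1.
move=> u v; rewrite !inE => /forallP hu /forallP hv; apply/forallP => a.
by rewrite !permM (eqP (hu a)) (eqP (hv _)).
Qed.

Canonical SB_group := Group SB_group_set.

Definition window (w : {perm pmset n}) : seq int :=
  [seq pmval (w (false, i)) | i <- enum 'I_n].

(* The integer w(i), for 1 <= i <= n. *)
Definition letter (w : {perm pmset n}) (i : nat) : int :=
  nth 0%R (window w) i.-1.

Lemma letterE (w : {perm pmset n}) (i : 'I_n) :
  letter w i.+1 = pmval (w (false, i)).
Proof.
rewrite /letter /= (nth_map i) ?size_enum_ord //; congr (pmval (w (_, _))).
by apply: val_inj; rewrite /= nth_enum_ord.
Qed.

(* For j with value 0, sB j is s_0, which exchanges 1 and -1. For j with value *)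
(* i >= 1, it is s_i, which exchanges i with i+1 and -i with -(i+1): the       *)
(* letters i and i+1 are encoded by the ordinals i-1 and i.                    *)
Definition sB (j : 'I_n) : {perm pmset n} :=
  if val j == 0 then tperm (false, j) (true, j)
  else let k : 'I_n := ord_pred j in
       (tperm (false, k) (false, j) * tperm (true, k) (true, j))%g.

End SignedPermutations.

(* S ^+ k is the set of products of k elements of S. *)
Lemma word_exists (gT : finGroupType) (S : {set gT}) (x : gT) :
  exists k, (x \in <<S>>%g) ==> (x \in (S ^+ k)%g).
Proof.
case: (boolP (x \in <<S>>%g)) => [/gen_prodgP[k [c Sc ->]]|_]; last by exists 0.
by exists k; rewrite -[k in (S ^+ k)%g]card_ord -prodg_const mem_prodg.
Qed.

(* The least k such that x is a product of k elements of S; it is 0 by         *)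
(* convention if x is not in the subgroup generated by S. By SB_gen below this *)
(* case does not arise for signed permutations and the generators s_i.         *)
Definition word_length (gT : finGroupType) (S : {set gT}) (x : gT) : nat :=
  ex_minn (word_exists S x).

Definition ellB (n : nat) (w : {perm pmset n}) : nat :=
  word_length [set sB j | j : 'I_n] w.

Lemma pmoppK n : involutive (@pmopp n).
Proof. by case=> b i; rewrite /pmopp /= negbK. Qed.
Lemma pmopp_neq n (a : pmset n) : (pmopp a == a) = false.
Proof. by case: a => [[] i]. Qed.

(* Exchanges a with b and -a with -b. *)
Definition sw n (a b : pmset n) : {perm pmset n} :=
  (tperm a b * (if pmopp a == b then 1 else tperm (pmopp a) (pmopp b)))%g.

Lemma ord_predE n (j : 'I_n) (h: val j != 0) : ord_pred j = j.-1 :> nat.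
Proof. case: j h => [[|j] hj] //= _. rewrite modnDr modn_small //. lia. Qed.

Lemma sw_conj n a b (g : {perm pmset n}) : g \in SB n -> (sw a b ^ g)%g = sw (g a) (g b).
Proof.
rewrite inE => /forallP hg; rewrite /sw conjMg tpermJ -(eqP (hg a)) (inj_eq perm_inj).
by case: ifP => _; rewrite ?conj1g // tpermJ (eqP (hg _)) (eqP (hg _)).
Qed.

Lemma tC n (a b : pmset n) : pmopp a != b -> commute (tperm a b) (tperm (pmopp a) (pmopp b)).
Proof.
move=> h; have h' : a != pmopp b by apply: contra h => /eqP ->; rewrite pmoppK.
case: (a =P b) => [->|/eqP ne]; first by rewrite tperm1; apply: commute_sym; apply: commute1.
apply: commute_sym; apply/commgP/conjg_fixP; rewrite tpermJ; congr tperm; rewrite tpermD //.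
- by rewrite eq_sym pmopp_neq.
- by rewrite eq_sym.
- by rewrite eq_sym pmopp_neq.
Qed.

Lemma SB_J n (w : {perm pmset n}) : (w ^ perm (can_inj (@pmoppK n)) = w)%g -> w \in SB n.
Proof.
move=> h; rewrite inE; apply/forallP => a; rewrite -{1}h.
by have := permJ w (perm (can_inj (@pmoppK n))) a; rewrite !permE => ->.
Qed.

Lemma sw_SB n (a b : pmset n) : sw a b \in SB n.
Proof.
apply: SB_J; rewrite /sw; case: (pmopp a =P b) => [<-|/eqP h].
  by rewrite mulg1 tpermJ !permE pmoppK tpermC.
by rewrite conjMg !tpermJ !permE !pmoppK tC.
Qed.

Lemma sB_sw n (j : 'I_n) : sB j = if val j == 0 then sw (false, j) (true, j) else sw (false, ord_pred j) (false, j).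
Proof. by rewrite /sB /sw; case: ifP => // _; rewrite /pmopp eqxx mulg1. Qed.

Lemma sB_SB n (j : 'I_n) : sB j \in SB n.
Proof. by rewrite sB_sw; case: ifP => _; apply: sw_SB. Qed.

Lemma letter_s0 n (i j : 'I_n) : val j = 0 -> letter (sB j) i.+1 = (if val i == 0 then -1 else i.+1%:Z)%R.
Proof.
move=> hj; rewrite letterE /sB hj /=.
case: eqP => hi.
  have -> : i = j by apply: val_inj; rewrite /= hi.
  by rewrite tpermL /pmval /= hj.
rewrite tpermD /pmval /= ?GRing.mul1r //; apply/eqP => -[] // e; apply: hi; by rewrite -e.
Qed.

Lemma letter_si n (i j : 'I_n) : val j != 0 -> letter (sB j) i.+1 =
  (if i.+1 == j then j.+1%:Z else if i == j then (j:nat)%:Z else i.+1%:Z)%R.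
Proof.
move=> hj; rewrite letterE sB_sw (negbTE hj) /sw /= permM.
have hp := ord_predE hj.
have x: i.+1 == j = (i == ord_pred j) by rewrite -[RHS](inj_eq (@ord_inj n)) hp; move: hj => /=; lia.
rewrite x; case: (i =P ord_pred j) => [->|h1].
  by rewrite tpermL tpermD // /pmval /= GRing.mul1r.
case: (i =P j) => [->|h2].
  have e: (ord_pred j).+1 = j by rewrite hp; move: hj => /=; lia.
  by rewrite tpermR tpermD // -e /pmval GRing.mul1r.
rewrite !tpermD // /pmval /= ?GRing.mul1r //; apply/eqP => -[] // e; congruence.
Qed.

Lemma SB_gen n : <<[set sB j | j : 'I_n]>>%g = SB n.
Proof.
pose G := (<<[set sB j | j : 'I_n]>>)%G; change (G = SB n :> {set _}).
have sG j : sB j \in G by apply: mem_gen; apply: imset_f.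
apply/eqP; rewrite eqEsubset; apply/andP; split.
  by rewrite (gen_subG _ (SB_group n)); apply/subsetP => _ /imsetP[j _ ->]; apply: sB_SB.
have cl a b g : g \in G -> g \in SB n -> sw a b \in G -> sw (g a) (g b) \in G.
  by move=> gG gS h; rewrite -sw_conj // groupJ.
have adj (j : 'I_n) k : k = j.+1 :> nat -> forall h : k < n, sw (false, j) (false, Ordinal h) \in G.
  move=> e h; have := sG (Ordinal h); rewrite sB_sw /=; case: eqP => [|/eqP h0]; first lia.
  suff -> : ord_pred (Ordinal h) = j by []. apply: ord_inj; rewrite (ord_predE (j:=Ordinal h)) //=; lia.
have T i : sw (false, i) (true, i) \in G.
  case: i => i; elim: i => [|i IH] h; first by have := sG (Ordinal h); rewrite sB_sw.
  have h' : i < n by lia.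
  have := cl _ _ _ (adj (Ordinal h') i.+1 erefl h) (sw_SB _ _) (IH h').
  rewrite /sw /= /pmopp /= !permM tpermL tpermD // [tperm (false,_) _ (true,_)]tpermD // tpermL.
  by rewrite eqxx.
have U (i j : 'I_n) : i < j -> sw (false, i) (false, j) \in G.
  case: j => j; elim: j => [|j IH] h //= ij.
  have h' : j < n by lia.
  case: (ltngtP i j) => [ij'|ij'|e]; [|lia|by apply: adj; rewrite e].
  have := cl _ _ _ (adj (Ordinal h') j.+1 erefl h) (sw_SB _ _) (IH h' ij').
  have D (x y : 'I_n) : (x != y) -> (false, x) != (false, y) by apply: contra => /eqP[->].
  rewrite /sw /= /pmopp /= !permM.
  rewrite [tperm _ _ (false,i)]tpermD ?[tperm _ _ (false,i)]tpermD ?tpermL ?[tperm _ _ (false, Ordinal h)]tpermD //; 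
    by apply: D; rewrite -val_eqE /=; lia.
have swC (a b : pmset n) : sw a b = sw b a.
  rewrite /sw tpermC; have -> : (pmopp a == b) = (pmopp b == a).
    by apply/eqP/eqP => <-; rewrite pmoppK.
  by case: ifP => _ //; rewrite [tperm (pmopp a) _]tpermC.
have swN (a b : pmset n) : sw (pmopp a) (pmopp b) = sw a b.
  rewrite /sw !pmoppK; have -> : (a == pmopp b) = (pmopp a == b).
    by apply/eqP/eqP => [->|<-]; rewrite pmoppK.
  case: (pmopp a =P b) => [<-|/eqP h].
    by rewrite pmoppK tpermC.
  by rewrite tC.
have A a b : sw a b \in G.
  have sT : forall i j : 'I_n, sw (false, i) (false, j) \in G.
    move=> i j; case: (ltngtP i j) => h; [exact: U|rewrite swC; exact: U|].
    have -> : i = j by apply: val_inj.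
    by rewrite /sw /pmopp /= !tperm1 mulg1.
  have sN i j : sw (true, i) (false, j) \in G.
    case: (i =P j) => [->|h]; first by rewrite swC.
    have := cl _ _ _ (T i) (sw_SB _ _) (sT i j).
    rewrite /sw /pmopp /= eqxx mulg1 tpermL [tperm _ _ (_,j)]tpermD //; by apply/eqP => -[].
  case: a b => [[] i] [[] j] //.
    by have := sT i j; rewrite -swN.
  by rewrite swC.
apply/subsetP => w; move: {2}#|_|.+1 (ltnSn #|[set a | w a != a]|) => m.
elim: m w => // m IH w hm wS.
case: (set_0Vmem [set a | w a != a]) => [e0|[a]].
  suff -> : w = 1%g by [].
  apply/permP => a; rewrite perm1; apply/eqP; have := in_set0 a; rewrite -e0 inE.
  by move/negbT; rewrite negbK.
rewrite inE => ha.
rewrite -(groupMr _ (A a (w a))).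
apply: IH; last by rewrite (groupM (G:=SB_group n)) // sw_SB.
rewrite ltnS in hm; apply: (leq_trans (proper_card _) hm); apply/properP; split; last first.
  exists a; rewrite !inE ?ha // negbK /sw !permM tpermR.
  case: ifP => h; rewrite ?perm1 // tpermD //.
    by rewrite pmopp_neq.
  by apply/eqP => e; move: h; rewrite -{1}e pmoppK eqxx.
have wN c : w (pmopp c) = pmopp (w c) by move: wS; rewrite inE => /forallP/(_ c)/eqP.
apply/subsetP => c; rewrite !inE; apply: contra => /eqP hc.
rewrite /sw permM hc permM.
have n1 : a != c by apply: contra ha => /eqP ->; rewrite hc.
have n2 : w a != c by apply: contra n1 => /eqP e; apply/eqP; apply: (@perm_inj _ w); rewrite e hc.
have n3 : pmopp a != c by apply/eqP=> e; move: hc; rewrite -e wN => /(can_inj (@pmoppK n)) e'; rewrite e' eqxx in ha.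
rewrite tpermD //; case: ifP => _; rewrite ?perm1 // tpermD //.
apply: contra n3 => /eqP e; apply/eqP; apply: (@perm_inj _ w); by rewrite wN e hc.
Qed.

Definition maj (n : nat) (w : {perm pmset n}) : nat :=
  \sum_(1 <= i < n | (letter w i > letter w i.+1)%R) i.

Definition Neg (n : nat) (w : {perm pmset n}) : seq nat :=
  [seq i <- iota 1 n | (letter w i < 0)%R].

Definition nmaj (n : nat) (w : {perm pmset n}) : int :=
  ((maj w)%:Z - \sum_(i <- Neg w) letter w i)%R.

Lemma nmaj_ge0 (n : nat) (w : {perm pmset n}) : (0 <= nmaj w)%R.
Proof.
rewrite /nmaj -sumrN addr_ge0 // big_seq sumr_ge0 // => i.
by rewrite mem_filter oppr_ge0 => /andP[/ltW].
Qed.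

Definition nmajs (n : nat) (w : {perm pmset n}) : int := nmaj (w^-1)%g.

Definition fmaj (n : nat) (w : {perm pmset n}) : nat :=
  2 * maj w + size (Neg w).

(* N[x, y] is represented as N[x][y]. *)
Definition varx : {poly {poly nat}} := ('X%:P)%R.
Definition vary : {poly {poly nat}} := ('X)%R.

(* Main.v *)
Require Import Defs.
From mathcomp Require Import all_boot all_order all_algebra all_fingroup.
From mathcomp Require Import zify.

Set Implicit Arguments.
Unset Strict Implicit.
Unset Printing Implicit Defensive.

Import Order.TTheory GRing.Theory Num.Theory.

(** Write t for the word t_1 ... t_n of the inverse of w, that is
    t_k = w^-1(k). Every statistic in the identity can be read on t.

    - The length of w is inv(t) plus the sum of |t_k| over the negative letters
      of t ([ellB_word_length]). Multiplying w on the right by a generator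
      exchanges two neighbouring letters of t or changes the sign of the first
      one, and either move changes this number by exactly one.
    - By definition nmaj*(w) = nmaj(w^-1) is maj(t) plus the same sum over the
      negative letters of t ([absz_nmaj]).
    - The integer w(k) is, up to sign, the place of the letter k or -k in t
      ([letterV]). Hence Neg(w) only depends on the set of letters of t, and the
      descents of w only depend on that set and on which of the letters z and
      z + 1 comes first in t, for each z such that both occur. So the same is
      true of fmaj(w).

    It is thus enough to have a bijection on words that turns maj into inv, that
    permutes the letters of each word, and that never changes the order in which
    two letters z and z + 1 appear. Foata's second fundamental transformation is
    such a bijection: see [inversions_foata], [foata_inj], [perm_foata] and
    [filter_foata]. Carried over to signed permutations through t, it is a
    permutation of the group that takes nmaj* to the length and fixes fmaj
    ([foata_equidistribution]). *)

(** * Inversions, major index and Foata's transformation *)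

Section Words.
Context {d : Order.disp_t} {T : orderType d}.
Implicit Types (s u r : seq T) (x y z a b c : T) (p q : pred T).

Fixpoint inversions s : nat :=
  if s is x :: s' then count (fun y => (y < x)%O) s' + inversions s' else 0.

Definition word_maj x0 s : nat :=
  \sum_(1 <= i < size s | (nth x0 s i < nth x0 s i.-1)%O) i.

Lemma inversions_rcons s a :
  inversions (rcons s a) = inversions s + count (fun y => (a < y)%O) s.
Proof. elim: s => //= x s ->; rewrite -cats1 count_cat /=; lia. Qed.

Lemma inversions_swap u x y r : (y < x)%O ->
  inversions (u ++ x :: y :: r) = (inversions (u ++ y :: x :: r)).+1.
Proof.
move=> yx; elim: u => [|z u IH] /=.
  by rewrite yx (lt_gtF yx); lia.
by rewrite IH addnS !count_cat /=; lia.
Qed.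

Lemma word_maj_rcons x0 s a :
  word_maj x0 (rcons s a) =
  word_maj x0 s + (if (last a s <= a)%O then 0 else size s).
Proof.
case: (lastP s) => [|u b]; first by rewrite /word_maj !big_geq //=; case: (_ <= _)%O.
rewrite last_rcons /word_maj !size_rcons big_mkcond big_nat_recr //= -big_mkcond /=.
congr (_ + _); last first.
  by rewrite !nth_rcons !size_rcons ltnn eqxx ltnSn ltnn eqxx ltNge; case: (_ <= _)%O.
rewrite big_nat_cond [RHS]big_nat_cond; apply: eq_bigl => i.
case: (ltnP i (size u).+1) => h; rewrite ?andbF // andbT.
rewrite ![nth x0 (rcons (rcons u b) a) _]nth_rcons size_rcons h.
by have -> : i.-1 < (size u).+1 by lia.
Qed.

(** Cut [s] after each letter that satisfies [p]; when the last letter satisfies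
    [p], every block has the form x_1 ... x_k y with y its only letter in [p],
    and the result replaces it by y x_1 ... x_k. Reading from the right, each
    x_i only has to be exchanged with the head of what follows, which is y. *)
Fixpoint rotate_blocks p s : seq T :=
  if s is x :: s' then
    if p x then x :: rotate_blocks p s'
    else if rotate_blocks p s' is y :: r then y :: x :: r else [:: x]
  else [::].

Lemma perm_rotate_blocks p s : perm_eq (rotate_blocks p s) s.
Proof.
elim: s => //= x s IH; case: ifP => _; first by rewrite perm_cons.
rewrite -(perm_cons x) in IH.
case: (rotate_blocks p s) IH => [|y r] //= h.
by rewrite -(permPr h) (perm_catCA [:: y] [:: x] r).
Qed.

(** The default [z] stands for the last letter of the empty word, so that this
    hypothesis (and the same one below) covers that case without a side
    condition. *)
Lemma head_rotate_blocks p z s : p (last z s) -> p (head z (rotate_blocks p s)).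
Proof.
elim: s z => //= x s IH z /IH; case: ifP => // px.
by case: (rotate_blocks p s) => [|y r] //=; rewrite px.
Qed.

(** The second letter of the image tells whether the first block of the source
    had a single letter: it satisfies [p] exactly in that case, since it is then
    the head of the next block. *)
Lemma rotate_blocks_inj p z s1 s2 : p (last z s1) -> p (last z s2) ->
  rotate_blocks p s1 = rotate_blocks p s2 -> s1 = s2.
Proof.
have sz s : size (rotate_blocks p s) = size s.
  exact/perm_size/perm_rotate_blocks.
elim: s1 z s2 => [|x1 s1 IH] z [|x2 s2] l1 l2 e //; try by have := congr1 size e; rewrite !sz.
move: l1 l2 e => /= l1 l2.
have := (head_rotate_blocks l1, head_rotate_blocks l2).
have := (sz s1, sz s2).
have IH' y : p (last y s1) -> p (last y s2) -> rotate_blocks p s1 = rotate_blocks p s2 -> s1 = s2.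
  exact: IH.
have L s x y : s != [::] -> p (last x s) -> p (last y s) by case: s.
case: ifP => p1; case: ifP => p2.
- move=> _ _ [<- e]; congr (_ :: _); case: (eqVneq s2 [::]) e => [->|n2] e.
    by apply/nilP; rewrite /nilp -sz e.
  by apply: (IH' x1) => //; apply: L l2.
- case: (rotate_blocks p s2) => [|y2 r2] /=; first by rewrite p2 => _ [].
  case e1: (rotate_blocks p s1) => [|y1 r1] //= _ [h1 h2] [] // _ e3.
  by move: h1; rewrite e3 p2.
- case: (rotate_blocks p s1) => [|y1 r1] /=; first by rewrite p1 => _ [].
  case e1: (rotate_blocks p s2) => [|y2 r2] //= _ [h1 h2] [] // _ e3.
  by move: h2; rewrite -e3 p1.
- case e1: (rotate_blocks p s1) => [|y1 r1] /=; first by rewrite p1 => _ [].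
  case e2: (rotate_blocks p s2) => [|y2 r2] /=; first by rewrite p2 => _ [].
  move=> _ _ [e3 e4 e5]; subst; congr (_ :: _).
  by apply: (IH' x2) => //; rewrite e1 e2.
Qed.

(** Each elementary exchange involves one letter in [p] and one outside [p], so
    letters on the same side of [p] keep their relative order. *)
Lemma filter_rotate_blocks p q z s :
  {in s &, forall x y, q x -> q y -> p x = p y} -> p (last z s) ->
  filter q (rotate_blocks p s) = filter q s.
Proof.
elim: s z => //= x s IH z hq l.
have {}IH : filter q (rotate_blocks p s) = filter q s.
  by apply: (IH x) => // a b sa sb; apply: hq; rewrite inE (sa, sb) orbT.
have hd := head_rotate_blocks l.
case: ifP => px /=; first by rewrite IH.
move: IH (perm_mem (perm_rotate_blocks p s)).
case: (rotate_blocks p s) hd => [|y r] /=; first by rewrite px.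
move=> py <- my; case: ifP => qy; case: ifP => qx //.
have : p x = p y by apply: hq => //; rewrite inE ?eqxx // -my inE eqxx orbT.
by rewrite px py.
Qed.

(** Let the cuts be made after the letters that are at most [a]. Then each letter
    greater than [a] jumps over a smaller one: the rotation destroys one
    inversion per such letter, and appending [a] creates as many again. If the
    cuts are made after the letters greater than [a], each letter at most [a]
    creates an inversion, and appending [a] adds one for each of the others:
    [size s] in all. *)
Lemma inversions_rotate_blocks a (c : bool) z s :
  let p y := (y <= a)%O == c in p (last z s) ->
  inversions (rcons (rotate_blocks p s) a) =
  inversions s + (if c then 0 else size s).
Proof.
move=> p l; rewrite inversions_rcons.
rewrite (seq.permP (perm_rotate_blocks p s)).
have -> : count (fun y => (a < y)%O) s = count (fun y => ~~ (y <= a)%O) s.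
  by apply: eq_count => y; rewrite ltNge.
elim: s z l => [|x s IH] z /= l; first by case: c {p l}.
have {}IH := IH x l; have hd := head_rotate_blocks l.
case: ifP => px /=.
  rewrite (seq.permP (perm_rotate_blocks p s)).
  by move: IH px; rewrite {hd l}/p; case: c => /= + /eqP ->; lia.
move: IH; rewrite -!(seq.permP (perm_rotate_blocks p s)).
have: size (rotate_blocks p s) = size s by apply/perm_size/perm_rotate_blocks.
case: (rotate_blocks p s) hd => [|y r] /= hd; first by rewrite px in hd.
move=> sz IH; move: px hd IH (@inversions_swap [::] x y r) (@inversions_swap [::] y x r) => /=.
rewrite /p -sz; case: c {p l} => /=.
  case: (leP x a) => //= ax _ /eqP ya IH h _; move: (h (le_lt_trans ya ax)); lia.
case: (leP x a) => //= ax _; case: (leP y a) => //= ya _ IH _ h.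
by move: (h (le_lt_trans ax ya)); lia.
Qed.

(** The letters are compared with [a] in such a way that the last letter of [s]
    ends a block. *)
Definition foata_step s a :=
  rcons (rotate_blocks (fun y => (y <= a)%O == (last a s <= a)%O) s) a.

Definition foata s := foldl foata_step [::] s.

Lemma foata_rcons s a : foata (rcons s a) = foata_step (foata s) a.
Proof. exact: foldl_rcons. Qed.

Lemma perm_foata s : perm_eq (foata s) s.
Proof.
elim/last_ind: s => // s a IH; rewrite foata_rcons /foata_step -!cats1.
by rewrite perm_cat2r (perm_trans (perm_rotate_blocks _ _)).
Qed.

Lemma last_foata a s : last a (foata s) = last a s.
Proof. by case: (lastP s) => // r b; rewrite foata_rcons !last_rcons. Qed.

(** Appending [a] adds [size s] to the major index if the last letter of [s] is
    greater than [a], and nothing otherwise. A Foata step changes the number of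
    inversions by the same amount, and it sees the same last letter because the
    transformation fixes the last letter of every word. *)
Theorem inversions_foata x0 s : inversions (foata s) = word_maj x0 s.
Proof.
elim/last_ind: s => [|s a IH]; first by rewrite /word_maj big_geq.
rewrite foata_rcons /foata_step (@inversions_rotate_blocks _ _ a) //.
by rewrite IH word_maj_rcons last_foata (perm_size (perm_foata s)).
Qed.

(** The last letter [a] is visible in the image, and so is the side of [a] on
    which the blocks were cut: the letter at the head of the rotated word is on
    that side. *)
Lemma foata_inj : injective foata.
Proof.
move=> s1; elim/last_ind: s1 => [|s1 a IH] s2 e.
  by apply/esym/nilP; rewrite /nilp -(perm_size (perm_foata s2)) -e.
case: (lastP s2) e => [|r b] e.
  by have := perm_size (perm_foata (rcons s1 a)); rewrite e size_rcons.
move: e; rewrite !foata_rcons => /rcons_inj [e ab]; subst b.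
pose cut u y := (y <= a)%O == (last a u <= a)%O.
have hd u : cut u (head a (rotate_blocks (cut u) u)).
  by apply: head_rotate_blocks; apply: eqxx.
have el : (last a (foata s1) <= a)%O = (last a (foata r) <= a)%O.
  have := hd (foata r); have := hd (foata s1); rewrite /cut -e.
  by move=> /eqP h1 /eqP h2; apply: etrans (esym h1) h2.
rewrite el in e.
by congr rcons; apply/IH/(rotate_blocks_inj (z := a) _ _ e) => /=; rewrite ?el eqxx.
Qed.

(** Two letters are exchanged only when a letter [a] that comes after both of
    them separates them: one is at most [a], the other greater. If no letter of
    the word separates two letters selected by [q], apart from the smaller of
    the two, then the subword selected by [q] is preserved. *)
Lemma filter_foata q s : uniq s ->
  {in s & &, forall a x y, q x -> q y -> (x <= a < y)%O -> x = a} ->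
  filter q (foata s) = filter q s.
Proof.
elim/last_ind: s => // s a IH; rewrite rcons_uniq => /andP[a_s us] hq.
have in_s x : x \in s -> x \in rcons s a by rewrite mem_rcons inE => ->; rewrite orbT.
rewrite foata_rcons /foata_step !filter_rcons (@filter_rotate_blocks _ _ a) //=.
  by rewrite IH // => b x y sb sx sy; apply: hq; apply: in_s.
have sep x y : x \in s -> y \in s -> q x -> q y -> (x <= a)%O -> (y <= a)%O.
  move=> sx sy qx qy xa; rewrite leNgt; apply/negP => ay.
  have ex : x = a by apply: (hq a x y) => //; rewrite ?xa // ?mem_rcons ?mem_head //
      inE (sx, sy) orbT.
  by rewrite -ex sx in a_s.
move=> x y; rewrite !(perm_mem (perm_foata s)) => sx sy qx qy; congr (_ == _).
by apply/idP/idP; apply: sep.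
Qed.

Lemma ltn_index_filter q b c s : q b -> q c ->
  (index b (filter q s) < index c (filter q s)) = (index b s < index c s).
Proof.
move=> qb qc; elim: s => //= x s IH; case: ifP => qx /=.
  by case: eqP => _; case: eqP => _ //; rewrite !ltnS.
have [xb|_] := eqVneq x b; first by rewrite xb qb in qx.
by have [xc|_] := eqVneq x c; [rewrite xc qc in qx | rewrite ltnS].
Qed.

End Words.

(** * Words of signed letters *)

Section Letters.
Implicit Types (s t : seq int).

Local Open Scope ring_scope.

Definition negsum s : nat := (\sum_(z <- s | (z < 0)%R) `|z|)%N.

Definition word_length_B s : nat := (inversions s + negsum s)%N.

Definition signed_word n s := perm_eq [seq `|z|%N | z <- s] (iota 1 n).

Lemma signed_word_uniq n s : signed_word n s -> uniq s.
Proof.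
move=> h; apply: (@map_uniq _ _ absz); by rewrite (perm_uniq h) iota_uniq.
Qed.

Lemma word_length_B_swap p x y r : y < x ->
  word_length_B (p ++ x :: y :: r) = (word_length_B (p ++ y :: x :: r)).+1.
Proof.
move=> yx; rewrite /word_length_B (inversions_swap _ _ yx) addSn; congr (_ + _).+1.
apply: perm_big; rewrite perm_cat2l; exact/permEl/(perm_catCA [:: x] [:: y] r).
Qed.

(** Changing the first letter from [a] to [-a] adds [a] to the sum over the
    negative letters. The inversions lost are those with the letters z such that
    -a <= z < a, and there are [a - 1] of them: one for each absolute value
    below [a]. *)
Lemma word_length_B_flip n a t : signed_word n (a :: t) -> 0 < a ->
  word_length_B (- a :: t) = (word_length_B (a :: t)).+1.
Proof.
move=> sw_t a0; have := perm_uniq sw_t; rewrite /= iota_uniq => /andP[a_t _].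
rewrite /word_length_B /negsum !big_cons oppr_lt0 a0 (lt_gtF a0) abszN /=.
suff -> : count (fun y => y < a) t = (count (fun y => (y < - a)%R) t + `|a|.-1)%N.
  have /prednK <- : (0 < `|a|)%N by lia.
  by rewrite addSn addnS /= -!addnA; congr (_ + _).+1; rewrite addnCA.
have -> : `|a|.-1 = count (fun k => (k < `|a|)%N) [seq `|z|%N | z <- a :: t].
  rewrite (seq.permP sw_t).
  have : (`|a| \in iota 1 n)%N by rewrite -(perm_mem sw_t) /= mem_head.
  rewrite mem_iota => /andP[a1 an].
  rewrite -[n](@subnKC `|a|.-1) ?iotaD ?count_cat; last lia.
  rewrite (@eq_in_count _ _ predT (iota 1 _)) ?count_predT ?size_iota.
    rewrite (@eq_in_count _ _ pred0) ?count_pred0 ?addn0 // => k.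
    by rewrite mem_iota /=; lia.
  by move=> k; rewrite mem_iota /=; lia.
rewrite /= ltnn add0n count_map -count_predUI addnC.
rewrite (@eq_count _ (predI _ _) pred0) ?count_pred0 => [|z /=]; last by apply/negP; lia.
apply: eq_in_count => z zt /=.
have : `|z|%N != `|a|%N.
  by apply: contra a_t => /eqP <-; apply: map_f.
by lia.
Qed.

Lemma sorted_inversions s : sorted <=%R s -> inversions s = 0%N.
Proof.
elim: s => //= x s IH xs; rewrite IH ?(path_sorted xs) // addn0.
rewrite (@eq_in_count _ _ pred0) ?count_pred0 // => y ys /=.
by apply/negbTE; rewrite -leNgt; apply: (allP (order_path_min le_trans xs)).
Qed.

Lemma path_word_length_B s : path <=%R 0 s -> word_length_B s = 0%N.
Proof.
move=> ps; rewrite /word_length_B sorted_inversions ?(path_sorted ps) //.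
rewrite /negsum big_seq_cond big1 // => z /andP[zs].
by rewrite ltNge (allP (order_path_min le_trans ps)).
Qed.

(** Without a descent, even after the 0 put in front, the letters are their own
    absolute values, and 1, ..., n has a single increasing arrangement. *)
Lemma path_signed_word n s : signed_word n s -> path <=%R 0 s ->
  s = [seq k%:Z | k <- iota 1 n].
Proof.
move=> sw_s ps; have s0 := allP (order_path_min le_trans ps).
have e : s = [seq k%:Z | k <- [seq `|z|%N | z <- s]].
  by rewrite -map_comp -[LHS]map_id; apply/eq_in_map => z /s0 /= /gez0_abs.
rewrite {1}e; congr map; apply: (sorted_eq leq_trans anti_leq) sw_s; last exact: iota_sorted.
move: (path_sorted ps); rewrite {1}e sorted_map; apply: sub_sorted => x y.
by rewrite /= lez_nat.
Qed.

(** An integer a such that z <= a < z + 1 is equal to z, so that no letter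
    separates [z] from [z + 1]. *)
Lemma ltn_index_foata (z b c : int) s : uniq s -> b \in [:: z; z + 1] -> c \in [:: z; z + 1] ->
  (index b (foata s) < index c (foata s))%N = (index b s < index c s)%N.
Proof.
move=> us hb hc; pose q := mem [:: z; z + 1].
rewrite -(@ltn_index_filter _ _ q) // filter_foata ?ltn_index_filter //.
move=> a x y _ _ _; rewrite /q /= !inE; lia.
Qed.

(** If [s] is the window of a signed permutation, this is the value at [k] of the
    inverse one: the place of the letter [k] or [-k] in [s], with its sign. *)
Definition inverse_letter s (k : nat) : int :=
  if k%:Z \in s then (index k%:Z s).+1%:Z else - (index (- k%:Z) s).+1%:Z.

Lemma inverse_letter_foata_lt0 s k :
  (inverse_letter (foata s) k < 0) = (inverse_letter s k < 0).
Proof. by rewrite /inverse_letter (perm_mem (perm_foata s)); case: ifP. Qed.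

(** When [k] and [k.+1] have different signs in [s], the comparison is decided by
    the signs. Otherwise it amounts to knowing which of two consecutive integers
    comes first: [k] and [k + 1], or [-(k + 1)] and [-k]. *)
Lemma inverse_letter_foata_descent s k : uniq s ->
  (inverse_letter (foata s) k > inverse_letter (foata s) k.+1) =
  (inverse_letter s k > inverse_letter s k.+1).
Proof.
move=> us; rewrite /inverse_letter !(perm_mem (perm_foata s)).
case: ifP => _; case: ifP => _ //.
  rewrite !ltz_nat !ltnS; apply: (@ltn_index_foata k) => //; rewrite !inE; lia.
rewrite !ltrN2 !ltz_nat !ltnS; apply: (@ltn_index_foata (- k.+1%:Z)) => //; rewrite !inE; lia.
Qed.

End Letters.

(** * Windows of signed permutations *)

Section Windows.
Variable n : nat.
Implicit Types (u w : {perm pmset n}) (i j : 'I_n).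

Local Open Scope ring_scope.

Lemma SB_opp w a : w \in SB n -> w (pmopp a) = pmopp (w a).
Proof. by rewrite inE => /forallP/(_ a)/eqP. Qed.

Lemma size_window w : size (window w) = n.
Proof. by rewrite size_map size_enum_ord. Qed.

Lemma nth_window w i : nth 0 (window w) i = pmval (w (false, i)).
Proof. exact: letterE. Qed.

Lemma window_letters w : window w = [seq letter w k | k <- iota 1 n].
Proof.
apply: (@eq_from_nth _ 0); rewrite size_window ?size_map ?size_iota // => i ltin.
by rewrite (nth_map 0%N) ?size_iota // nth_iota.
Qed.

Lemma abs_pmval (a : pmset n) : `|pmval a|%N = a.2.+1.
Proof. by rewrite /pmval abszMsign. Qed.

Lemma window_signed_word w : w \in SB n -> signed_word n (window w).
Proof.
move=> wS; rewrite /signed_word -map_comp.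
have uW : uniq [seq (absz \o (fun i => pmval (w (false, i)))) i | i <- enum 'I_n].
  rewrite map_inj_uniq ?enum_uniq // => i j /=; rewrite !abs_pmval => -[] /val_inj e.
  have : w (false, i) = w (false, j) \/ w (false, i) = w (true, j).
    rewrite -[(true, j)]/(pmopp (false, j)) SB_opp //.
    case: (w (false, i)) (w (false, j)) e => [b k] [c l] /= <-.
    by case: b; case: c; [left | right | right | left].
  by case=> /perm_inj [].
apply: uniq_perm => //; first exact: iota_uniq.
apply: (uniq_min_size uW _ _).2; last by rewrite size_map size_iota size_enum_ord.
by move=> _ /mapP[i _ ->]; rewrite /= abs_pmval mem_iota /= add1n ltnS ltn_ord.
Qed.

Lemma window_inj : {in SB n &, injective (@window n)}.
Proof.
move=> u w uS wS e; have e' i : u (false, i) = w (false, i).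
  by apply: pmval_inj; rewrite -!nth_window e.
apply/permP => -[[] i] //; rewrite -[(true, i)]/(pmopp (false, i)).
by rewrite !SB_opp // e'.
Qed.

Lemma signed_word_window s : signed_word n s ->
  exists2 w, w \in SB n & window w = s.
Proof.
move=> sw_s; have szs : size s = n by rewrite -(size_map absz) (perm_size sw_s) size_iota.
have /fin_all_exists[f fE] i : exists a : pmset n, pmval a = nth 0 s i.
  apply/pmval_range; have : (`|nth 0%R s i|%N \in iota 1 n).
    by rewrite -(perm_mem sw_s) map_f // mem_nth // szs.
  by rewrite mem_iota add1n ltnS.
pose g (a : pmset n) : pmset n := (a.1 (+) (f a.2).1, (f a.2).2).
have g_inj : injective g.
  move=> [b i] [c j]; rewrite /g /= => -[e1 e2].
  have eij : i = j.
    apply/val_inj/eqP; rewrite /= -(@nth_uniq _ 0%N [seq `|z|%N | z <- s]) ?size_map ?szs //.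
      by rewrite !(nth_map 0) ?szs // -!fE !abs_pmval e2.
    by rewrite (perm_uniq sw_s) iota_uniq.
  by subst j; rewrite (addIb e1).
exists (perm g_inj).
  by rewrite inE; apply/forallP => -[b i]; rewrite !permE /g /pmopp /= addNb.
apply: (@eq_from_nth _ 0); rewrite size_window // => i ltin.
rewrite -[i]/(nat_of_ord (Ordinal ltin)) nth_window permE -fE /g /=.
by case: (f _).
Qed.

Lemma absz_nmaj w : `|nmaj w|%N = (word_maj 0%R (window w) + negsum (window w))%N.
Proof.
rewrite /nmaj /Neg big_filter.
have -> : \sum_(k <- iota 1 n | letter w k < 0) letter w k = - (negsum (window w))%:Z.
  rewrite /negsum window_letters big_map (big_morph Posz PoszD (erefl _)) -sumrN.
  by apply: eq_bigr => i h; rewrite ltz0_abs // opprK.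
by rewrite opprK /word_maj size_window.
Qed.

Lemma sB_pos i j : val j != 0%N -> sB j (false, i) = (false, tperm (ord_pred j) j i).
Proof.
move=> j0; rewrite /sB (negbTE j0) permM; set k := ord_pred j.
have D x y : (false, x) != (true, y) :> pmset n by [].
case: (tpermP k j i) => [->|->|/eqP ik /eqP ij].
- by rewrite tpermL tpermD.
- by rewrite tpermR tpermD.
by rewrite !tpermD // eq_sym; apply/eqP => -[]; apply/eqP.
Qed.

(** * The length formula *)

Lemma window_mul_s0 u j : u \in SB n -> val j = 0%N ->
  window (sB j * u)%g = - head 0 (window u) :: behead (window u).
Proof.
move=> uS j0; have n0 : (0 < n)%N by rewrite -j0; apply: ltn_ord.
apply: (@eq_from_nth _ 0).
  by rewrite /= size_behead !size_window prednK.
rewrite size_window => i ltin; rewrite -[i]/(nat_of_ord (Ordinal ltin)) nth_window permM.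
rewrite /sB j0 /=; case: i ltin => [|i] ltin.
  have -> : Ordinal ltin = j by apply: val_inj.
  rewrite tpermL -[(true, j)]/(pmopp (false, j)) SB_opp // pmvalN -nth_window j0.
  by rewrite nth0.
rewrite tpermD // -?nth_window /= ?nth_behead //.
by apply/eqP => -[/(congr1 val)]; rewrite /= j0.
Qed.

Lemma window_mul_si u j p x y r : val j != 0%N -> size p = j.-1 ->
  window u = p ++ x :: y :: r -> window (sB j * u)%g = p ++ y :: x :: r.
Proof.
move=> j0 szp wE; have szw := size_window u; rewrite wE size_cat /= in szw.
have kE := ord_predE j0.
apply: (@eq_from_nth _ 0); first by rewrite size_window size_cat.
rewrite size_window => i ltin; rewrite -[i]/(nat_of_ord (Ordinal ltin)) nth_window permM.
rewrite sB_pos // -nth_window wE !nth_cat.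
have kE' : ord_pred j = size p :> nat by rewrite szp.
have jE : j = (size p).+1 :> nat by rewrite szp; move: j0 => /=; lia.
case: tpermP => [->|->|/eqP + /eqP +].
- rewrite kE' jE; rewrite !ltnn ltnNge leqnSn /= subSnn subnn //.
- by rewrite kE' jE ltnn ltnNge leqnSn /= subSnn subnn.
rewrite -!(inj_eq (@ord_inj n)) kE' jE /= => h1 h2; case: ifP => // h3.
by have -> : (i - size p = (i - size p).-2.+2)%N by lia.
Qed.

(** Putting 0 in front of the window treats the generator s_0 like the others: a
    negative first letter is a descent at the place 0. *)
Lemma word_length_B_mul_sB u j : u \in SB n ->
  if nth 0 (window u) j < nth 0 (0 :: window u) j
  then word_length_B (window u) = (word_length_B (window (sB j * u)%g)).+1
  else word_length_B (window (sB j * u)%g) = (word_length_B (window u)).+1.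
Proof.
move=> uS; have sw_u := window_signed_word uS; have szu := size_window u.
have ltj := ltn_ord j.
have [j0|j0] := eqVneq (val j) 0%N.
  rewrite (window_mul_s0 uS j0); move: j0 => /= -> /=.
  case: (window u) sw_u szu => [|a t] sw_u szu.
    by have := leq_ltn_trans (leq0n j) ltj; rewrite -[in X in (_ < X)%N]szu.
  have /= : (`|a|%N \in iota 1 n) by rewrite -(perm_mem sw_u) mem_head.
  rewrite mem_iota => /andP[a0 _]; case: ifP => ha.
    rewrite -{1}[a]opprK; apply: (@word_length_B_flip n); last by lia.
    by move: sw_u; rewrite /signed_word /= abszN.
  by apply: (@word_length_B_flip n) => //; lia.
have jE : j = (j.-1).+1 :> nat by move: j0 => /=; lia.
have [p [x [y [r [szp wE]]]]] : exists p x y r, size p = j.-1 /\ window u = p ++ x :: y :: r.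
  exists (take j.-1 (window u)), (nth 0 (window u) j.-1), (nth 0 (window u) j),
      (drop j.+1 (window u)).
  split; first by rewrite size_take szu; case: ltnP => //; lia.
  rewrite -drop_nth ?szu // [in drop j _]jE -drop_nth ?cat_take_drop // szu; lia.
rewrite (window_mul_si j0 szp wE) wE jE -szp /= !nth_cat ltnn subnn ltnNge leqnSn /= subSnn /=.
case: ifP => yx; first exact: word_length_B_swap.
apply: word_length_B_swap; rewrite lt_neqAle leNgt yx andbT.
have := signed_word_uniq sw_u; rewrite wE cat_uniq => /and3P[_ _] /=.
by rewrite inE negb_or => /andP[/andP[]].
Qed.

Lemma no_descent_id u : u \in SB n -> path <=%R 0 (window u) -> u = 1%g.
Proof.
move=> uS pu; apply: window_inj; rewrite ?group1 //.
rewrite (path_signed_word (window_signed_word uS) pu) window_letters.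
apply/eq_in_map => k; rewrite mem_iota add1n => /andP[k0 kn].
have kn' : (k.-1 < n)%N by lia.
have -> : k = (Ordinal kn').+1 by rewrite /= prednK.
by rewrite letterE perm1 /pmval /= mul1r.
Qed.

Lemma word_length_B1 : word_length_B (window (1%g : {perm pmset n})) = 0%N.
Proof.
apply: path_word_length_B; apply/(pathP 0) => i; rewrite size_window => ltin.
rewrite -{2}[i]/(nat_of_ord (Ordinal ltin)) nth_window perm1 /pmval mul1r /=.
case: i ltin => [|i] ltin //=; have ltin' : (i < n)%N by lia.
by rewrite -[i]/(nat_of_ord (Ordinal ltin')) nth_window perm1 /pmval mul1r /= lez_nat.
Qed.

(** One factor changes the right-hand side by one, so it is at most the length of
    any product of generators that is equal to [w]. Conversely, as long as the
    window has a descent, a generator decreases it, and the identity is the only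
    signed permutation without descents. The inverse of [w] appears because
    factors are removed on the right of [w], which multiplies [w^-1] on the
    left, where a generator acts on the places of the window. *)
Theorem ellB_word_length w : w \in SB n -> ellB w = word_length_B (window w^-1%g).
Proof.
move=> wS; set S := [set sB j | j : 'I_n].
have lower k x : x \in SB n -> x \in (S ^+ k)%g -> (word_length_B (window x^-1%g) <= k)%N.
  elim: k x => [|k IH] x xS.
    by rewrite expg0 => /set1P ->; rewrite invg1 word_length_B1.
  rewrite expgSr => /mulsgP[y _ yk /imsetP[j _ ->] xE].
  have yE : (y^-1 = sB j * x^-1)%g by rewrite xE invMg mulKVg.
  have yS : y \in SB n by rewrite -(groupMr _ (sB_SB j)) -xE.
  have := IH y yS yk; have xS' : x^-1%g \in SB n by rewrite groupV.
  by have := word_length_B_mul_sB j xS'; rewrite -yE; case: ifP => _ -> //; move/ltnW/leqW.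
have upper k x : x \in SB n -> word_length_B (window x^-1%g) = k -> x \in (S ^+ k)%g.
  elim: k x => [|k IH] x xS lx; move: (xS); rewrite -groupV => xS';
    have [px|/(pathP 0) npx] := boolP (path <=%R 0 (window x^-1%g)).
  - by rewrite expg0 -[x]invgK (no_descent_id xS' px) invg1 set11.
  - case: npx => i; rewrite size_window => ltin; rewrite leNgt; apply/negP => dx.
    by have := word_length_B_mul_sB (Ordinal ltin) xS'; rewrite /= dx lx.
  - by move: lx; rewrite path_word_length_B.
  have [j dx] : exists j : 'I_n, nth 0 (window x^-1%g) j < nth 0 (0 :: window x^-1%g) j.
    have [/existsP //|/existsPn nd] :=
      boolP [exists j : 'I_n, nth 0 (window x^-1%g) j < nth 0 (0 :: window x^-1%g) j].
    case: npx => i; rewrite size_window => ltin; rewrite leNgt.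
    exact: (nd (Ordinal ltin)).
  have := word_length_B_mul_sB j xS'; rewrite dx lx => -[lE].
  have /IH : (x * (sB j)^-1)%g \in SB n by rewrite groupMr ?groupV ?sB_SB.
  rewrite invMg invgK -lE => /(_ erefl) h.
  by rewrite expgSr -[x](mulgKV (sB j)) mem_mulg // imset_f.
rewrite /ellB /word_length; case: ex_minnP => m; rewrite SB_gen wS /= => wm min.
apply/eqP; rewrite eqn_leq lower // andbT; apply: min; exact: upper.
Qed.

(** * Statistics of a signed permutation on the window of its inverse *)

Lemma letterV w k : w \in SB n -> (0 < k <= n)%N ->
  letter w k = inverse_letter (window w^-1%g) k.
Proof.
move=> wS; case: k => // k /= ltkn; pose i := Ordinal ltkn.
have wS' : w^-1%g \in SB n by rewrite groupV.
have sw_w := window_signed_word wS'.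
rewrite -[k]/(nat_of_ord i) letterE; case wi : (w (false, i)) => [b l].
have wVl : (w^-1)%g (false, l) = (b, i).
  have : (w^-1)%g (b, l) = (false, i) by rewrite -wi permK.
  case: b {wi} => // wl.
  by rewrite -[(false, l)]/(pmopp (true, l)) SB_opp // wl.
have nthl : nth 0 (window w^-1%g) l = pmval (b, i) by rewrite nth_window wVl.
have szl : (l < size (window w^-1%g))%N by rewrite size_window.
have idx : index (pmval (b, i)) (window w^-1%g) = l.
  by rewrite -nthl index_uniq // (signed_word_uniq sw_w).
have mem_i : pmval (b, i) \in window w^-1%g by rewrite -nthl mem_nth.
move: idx mem_i; rewrite /inverse_letter; case: b {wi wVl nthl}; rewrite /pmval /= ?mulN1r ?mul1r.
  (* The letters k and -k cannot both occur, since absolute values do not repeat. *)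
  move=> idx mem_i; rewrite ifN ?idx //; apply/negP => mem_i'.
  have [/= j1 lj1 e1] := (nthP 0 mem_i); have [j2 lj2 e2] := (nthP 0 mem_i').
  have := perm_uniq sw_w; rewrite iota_uniq => uw.
  have : nth 0%N [seq `|z|%N | z <- window w^-1%g] j1 ==
      nth 0%N [seq `|z|%N | z <- window w^-1%g] j2.
    by rewrite !(nth_map 0) // e1 e2 abszN.
  by rewrite nth_uniq ?(size_map absz) // => /eqP j12; move: e1; rewrite j12 e2.
by move=> -> ->.
Qed.

Lemma fmaj_inverse_window w : w \in SB n ->
  let t := window w^-1%g in
  fmaj w = (2 * (\sum_(1 <= k < n | (inverse_letter t k > inverse_letter t k.+1)%R) k)
    + count (fun k => inverse_letter t k < 0)%R (iota 1 n))%N.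
Proof.
move=> wS /=; rewrite /fmaj /maj /Neg size_filter; congr (2 * _ + _)%N.
  rewrite big_nat_cond [RHS]big_nat_cond; apply: eq_bigl => k.
  by apply: andb_id2l => kn; rewrite !letterV //; lia.
by apply: eq_in_count => k; rewrite mem_iota add1n ltnS => kn; rewrite letterV.
Qed.

Lemma signed_word_foata s : signed_word n s -> signed_word n (foata s).
Proof. by move=> sw_s; rewrite /signed_word (permPl (perm_map _ (perm_foata s))). Qed.

Lemma SB_foata : exists phi : {perm pmset n} -> {perm pmset n},
  {in SB n, forall w, phi w \in SB n /\ window (phi w)^-1%g = foata (window w^-1%g)}.
Proof.
have ex w : exists u, w \in SB n -> u \in SB n /\ window u^-1%g = foata (window w^-1%g).
  have [wS|] := boolP (w \in SB n); last by exists 1%g.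
  have wS' : w^-1%g \in SB n by rewrite groupV.
  have [u uS uE] := signed_word_window (signed_word_foata (window_signed_word wS')).
  by exists u^-1%g; rewrite invgK groupV.
have [phi phiP] := fin_all_exists ex.
by exists phi => w wS; apply: phiP.
Qed.

(** The letters of the window of [w^-1] are permuted, so the sum over its negative
    letters is unchanged, while its major index becomes a number of inversions:
    this turns nmaj of [w^-1] into the length. *)
Theorem foata_equidistribution : exists phi : {perm pmset n} -> {perm pmset n},
  [/\ {in SB n &, injective phi}, phi @: SB n = SB n,
      {in SB n, forall w, ellB (phi w) = `|nmajs w|%N}
    & {in SB n, forall w, fmaj (phi w) = fmaj w}].
Proof.
have [phi phiP] := SB_foata; exists phi.
have phi_inj : {in SB n &, injective phi}.
  move=> u w uS wS e; apply: invg_inj; apply: window_inj; rewrite ?groupV //.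
  by apply: foata_inj; rewrite -(phiP u uS).2 -(phiP w wS).2 e.
split=> //.
- apply/eqP; rewrite eqEcard card_in_imset // leqnn andbT.
  by apply/subsetP => _ /imsetP[w wS ->]; case: (phiP w wS).
- move=> w wS; have [pS pE] := phiP w wS.
  rewrite ellB_word_length // pE /nmajs absz_nmaj /word_length_B (inversions_foata 0).
  by congr addn; apply/perm_big/perm_foata.
move=> w wS; have [pS pE] := phiP w wS.
have uw : uniq (window w^-1%g).
  by apply/(@signed_word_uniq n)/window_signed_word; rewrite groupV.
rewrite !fmaj_inverse_window // pE; congr (2 * _ + _)%N.
  by apply: eq_bigl => k; rewrite inverse_letter_foata_descent.
by apply: eq_count => k; rewrite inverse_letter_foata_lt0.
Qed.

End Windows.

(* nmajs w is a nonnegative integer (nmaj_ge0); the absolute value only        *)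
(* converts it to a natural number exponent.                                   *)
Theorem corollary5p6 (n : nat) (n_gt0 : 0 < n) :
  (\sum_(w in SB n) varx ^+ ellB w * vary ^+ fmaj w
   = \sum_(w in SB n) varx ^+ `|nmajs w|%N * vary ^+ fmaj w)%R.
Proof.
have [phi [phi_inj phi_SB ell_phi fmaj_phi]] := foata_equidistribution n.
rewrite -[in LHS]phi_SB big_imset //=; apply: eq_bigr => w wS.
by rewrite ell_phi ?fmaj_phi.
Qed.
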